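(* Let $d$ be a positive integer, $x\in\mathbb R$, $f$ a real-valued function which is $2d+1$ times differentiable at $x$, and $g$ a real-valued function which is $2d+1$ times differentiable at $f(x)$. Suppose $Df(x)\neq 0$, $Dg(f(x))\ne 0$ and $S_d(f)(x)$, $S_d(g)(f(x))$ and $S_d(g\circ f)(x)$ exist. Then $$S_d(g\circ f)(x) = S_d(g)(f(x))\,(Df(x))^{2d} + S_d(f)(x) + S_d\big([g]_{f(x)}^d\circ[f]_x^d\big)(x).$$
   Context: $D$ denotes differentiation; functions are defined on real neighbourhoods of the relevant points. Padé approximants and Schwarzian derivatives: a rational map is a quotient $p/q$ of polynomials with $q \not\equiv 0$; its degree is $\max(\deg p,\deg q)$ when $p,q$ are relatively prime. Let $k \ge 0$ be an integer and $h$ a real-valued function which is $2k$ times differentiable at a real point $y$. The $k$'th Padé approximant to $h$ at $y$, denoted $[h]_y^k$, is the rational map $\mathcal R$ of degree at most $k$ (finite at $y$) with $D^j\mathcal R(y) = D^j h(y)$ for $0 \le j \le 2k$, if such a map exists (it is then unique). If moreover $h$ is $2k+1$ times differentiable at $y$, $Dh(y) \ne 0$, $k\ge 1$, and $\mathcal R = [h]_y^k$ exists, the Schwarzian derivative of order $k$ is $S_k(h)(y) = D^{2k+1}(\mathcal R^{-1}\circ h)(y)$, where $\mathcal R^{-1}$ is the local inverse of $\mathcal R$ sending $h(y)$ to $y$; equivalently $S_k(h)(y) = D^{2k+1}(h-\mathcal R)(y)/Dh(y)$. We say $S_k(h)(y)$ exists when $[h]_y^k$ exists. *)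

(* Defs.v *)
(* MathComp-Analysis; the real line is an arbitrary [R : realType].  Functions
   defined near a point are total functions [R -> R], about which only local
   properties are ever stated. *)
From HB Require Import structures.
From mathcomp Require Import all_boot all_order all_algebra.
From mathcomp Require Import all_classical all_reals all_analysis.

Set Implicit Arguments.
Unset Strict Implicit.
Unset Printing Implicit Defensive.

Import Order.TTheory GRing.Theory Num.Theory.
Import numFieldNormedType.Exports.

Local Open Scope ring_scope.
Local Open Scope classical_set_scope.

(* [derive1n m h] is a total iterated derivative, so the derivative of order [m] has
   to be required to exist on a whole neighbourhood of [y] before it is
   differentiated at [y]. *)
Fixpoint times_differentiable (R : realType) (n : nat) (h : R -> R) (y : R) :
    Prop :=
  if n is m.+1 then
    (\forall z \near y, times_differentiable m h z) /\ derivable (derive1n m h) y 1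
  else True.

(* A rational map is represented by its unique fraction in lowest terms with
   monic denominator. *)
Record ratmap (R : realType) := Ratmap {
  fracpair : {poly R} * {poly R};
  _ : (fracpair.2 \is monic) && coprimep fracpair.1 fracpair.2
}.

HB.instance Definition _ (R : realType) := [isSub for @fracpair R].
HB.instance Definition _ (R : realType) := [Choice of ratmap R by <:].

Definition rnum (R : realType) (r : ratmap R) : {poly R} := (fracpair r).1.
Definition rden (R : realType) (r : ratmap R) : {poly R} := (fracpair r).2.

(* [size p] is one more than the degree of [p], and [size 0 = 0]. *)
Definition rdegree (R : realType) (r : ratmap R) : nat :=
  maxn (size (rnum r)).-1 (size (rden r)).-1.

Definition finite_at (R : realType) (r : ratmap R) (y : R) : Prop :=
  (rden r).[y] != 0.

(* Meaningful where [r] is finite; the value at a pole is the dummy [0]. *)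
Definition reval (R : realType) (r : ratmap R) (z : R) : R :=
  (rnum r).[z] / (rden r).[z].

Coercion reval : ratmap >-> Funclass.

Lemma zero_ratmap_subproof (R : realType) :
  ((1 : {poly R}) \is monic) && coprimep (0 : {poly R}) 1.
Proof. by rewrite monic1 coprimep1. Qed.

Definition zero_ratmap (R : realType) : ratmap R :=
  @Ratmap R (0, 1) (zero_ratmap_subproof R).

(* For [h] which is [2k] times differentiable at [y]. *)
Definition is_pade (R : realType) (k : nat) (h : R -> R) (y : R)
    (r : ratmap R) : Prop :=
  [/\ (rdegree r <= k)%N, finite_at r y &
      forall j : nat, (j <= 2 * k)%N -> derive1n j r y = derive1n j h y].

(* The Pade approximant [h]_y^k when it exists, and a dummy value otherwise. *)
Definition pade (R : realType) (k : nat) (h : R -> R) (y : R) : ratmap R :=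
  xget (zero_ratmap R) [set r | is_pade k h y r].

(* The germ of [phi] at [F y] is the local inverse of [F] sending [F y] to
   [y]. *)
Definition is_local_inverse (R : realType) (F : R -> R) (y : R)
    (phi : R -> R) : Prop :=
  [/\ phi (F y) = y,
      \forall z \near y, phi (F z) = z &
      \forall w \near F y, F (phi w) = w].

Definition local_inverse (R : realType) (F : R -> R) (y : R) : R -> R :=
  xget (idfun : R -> R) [set phi | is_local_inverse F y phi].

Definition schwarzian_exists (R : realType) (k : nat) (h : R -> R) (y : R) :
    Prop :=
  exists r : ratmap R, is_pade k h y r.

(* For [k >= 1] and [h] which is [2k+1] times differentiable at [y] with
   [derive1 h y != 0], such that [schwarzian_exists k h y]; the value does not
   depend on the chosen representative of the germ of the local inverse. *)
Definition schwarzian (R : realType) (k : nat) (h : R -> R) (y : R) : R :=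
  derive1n (2 * k).+1 (local_inverse (pade k h y) y \o h) y.

(* Main.v *)
Require Import Defs.
From HB Require Import structures.
From mathcomp Require Import all_boot all_order all_algebra.
From mathcomp Require Import all_classical all_reals all_analysis.
From mathcomp Require Import ring lra.
Import Order.TTheory GRing.Theory Num.Theory.
Import numFieldNormedType.Exports.
Local Open Scope ring_scope.
Local Open Scope classical_set_scope.

(* For [n >= 1], two functions that are [n] times differentiable at [x] have the
   same derivatives up to order [n] there iff they differ by [o((z - x)^n)].
   Let [F] and [G] be the Pade approximants of [f] at [x] and of [g] at [f x],
   and put [n = 2 d + 1].  Writing [g f - G F = (g - G) f + (G f - G F)] and
   expanding both terms to order [n] shows that [g f] and [G F] have the same
   derivatives up to order [2 d], hence the same Pade approximant at [x], and that
   their derivatives of order [n] differ by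
   [D^n(g - G)(f x) (f' x)^n + G'(f x) D^n(f - F)(x)].
   The same expansion, applied to a local inverse [phi] of the approximant [r] of
   a function [h] and to the identity [phi r = id], gives
   [S_d(h) = D^n(h - r) / h']; the claim follows on dividing by [(g f)' x]. *)

(** * Iterated differentiability at a point *)

Section IteratedDerivatives.
Context {R : realType}.
Implicit Types (f g h u v : R -> R) (x y z : R) (n m k : nat).

Lemma nearT (P : R -> Prop) x : (forall z, P z) -> \forall z \near x, P z.
Proof. by move=> HP; near=> z. Unshelve. all: by end_near. Qed.

Lemma near_near (P : R -> Prop) x :
  (\forall z \near x, P z) -> \forall z \near x, \forall w \near z, P w.
Proof. by move=> /nbhs_interior. Qed.

Lemma near_eq_derive1 u v x :
  (\forall z \near x, u z = v z) -> u^`() x = v^`() x.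
Proof. by move=> uv; rewrite !derive1E; exact: near_eq_derive. Qed.

Lemma near_eq_derive1n n u v x :
  (\forall z \near x, u z = v z) -> \forall z \near x, u^`(n) z = v^`(n) z.
Proof.
elim: n u v => [|n IH] u v uv //.
rewrite !derive1Sn; apply: IH.
by move/near_near : uv; apply: filterS => z; exact: near_eq_derive1.
Qed.

Lemma derive1n_near n u v x :
  (\forall z \near x, u z = v z) -> u^`(n) x = v^`(n) x.
Proof. by move/(near_eq_derive1n n)/nbhs_singleton. Qed.

Lemma near_eq_times_differentiable n u v x :
  (\forall z \near x, u z = v z) ->
  times_differentiable n u x -> times_differentiable n v x.
Proof.
elim: n x => [//|n IH] x uv [nu du]; split.
  by apply: filterS2 (near_near _ _ uv) nu => z; exact: IH.
by apply: near_eq_derivable du; exact: near_eq_derive1n.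
Qed.

Lemma times_differentiableW n h x :
  times_differentiable n.+1 h x -> times_differentiable n h x.
Proof. by case=> /nbhs_singleton. Qed.

Lemma times_differentiable_leq m n h x : (m <= n)%N ->
  times_differentiable n h x -> times_differentiable m h x.
Proof.
move=> /subnK <-; elim: (n - m)%N => // k IH.
by rewrite addSn => /times_differentiableW.
Qed.

Lemma times_differentiable1 h x :
  times_differentiable 1 h x <-> derivable h x 1.
Proof.
split; first by case.
move=> dh; split; last exact: dh.
exact: nearT.
Qed.

Lemma times_differentiable_derivable n h x :
  times_differentiable n.+1 h x -> derivable h x 1.
Proof. by move/(@times_differentiable_leq 1) => /(_ isT)[]. Qed.

(** The definition splits off the last derivative, while the rules of calculus need the first one
    split off. Order 1 at [x] gives no derivability near [x], so the statement starts at order 2 and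
    later inductions treat orders 0 and 1 separately. *)
Lemma times_differentiableSS n h x :
  times_differentiable n.+2 h x <->
  (\forall z \near x, derivable h z 1) /\ times_differentiable n.+1 h^`() x.
Proof.
split.
  move=> tdh; split.
    by case: tdh => + _; apply: filterS => z; exact: times_differentiable_derivable.
  elim: n x tdh => [|n IH] x; first by move=> [_ dh]; exact/times_differentiable1.
  case=> ndh dh; split; last by rewrite -derive1Sn.
  by move: ndh; apply: filterS => z /IH.
elim: n x => [|n IH] x [ndh [ndh' dh']].
  split; last exact: dh'.
  by move: ndh; apply: filterS => z /times_differentiable1.
split; last by rewrite derive1Sn.
by apply: filterS2 (near_near _ _ ndh) ndh' => z dz dz'; exact: IH.
Qed.

Lemma derivable_continuous h x : derivable h x 1 -> {for x, continuous h}.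
Proof. by move=> /derivable1_diffP; exact: differentiable_continuous. Qed.

Lemma continuous_near_neq0 f x : {for x, continuous f} -> f x != 0 ->
  \forall z \near x, f z != 0.
Proof. by move=> cf; exact: (cvgr_neq0 (f x) cf). Qed.

Let derive1RE h x : derive1 h x = 'D_1 h x. Proof. exact: derive1E. Qed.

Lemma derive1D f g x : derivable f x 1 -> derivable g x 1 ->
  derive1 (fun z => f z + g z) x = derive1 f x + derive1 g x.
Proof. by move=> df dg; rewrite !derive1RE; exact: deriveD. Qed.

Lemma derive1B f g x : derivable f x 1 -> derivable g x 1 ->
  derive1 (fun z => f z - g z) x = derive1 f x - derive1 g x.
Proof. by move=> df dg; rewrite !derive1RE; exact: deriveB. Qed.

Lemma derive1M f g x : derivable f x 1 -> derivable g x 1 ->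
  derive1 (fun z => f z * g z) x = f x * derive1 g x + g x * derive1 f x.
Proof. by move=> df dg; rewrite !derive1RE; exact: deriveM. Qed.

Lemma derive1V f x : f x != 0 -> derivable f x 1 ->
  derive1 (fun z => (f z)^-1) x = - (f x) ^- 2 * derive1 f x.
Proof. by move=> f0 df; rewrite !derive1RE; exact: deriveV. Qed.

Lemma times_differentiable_cst n (c : R) x : times_differentiable n (cst c) x.
Proof.
elim: n c x => [//|[|n] IH] c x.
  by apply/times_differentiable1; exact: derivable_cst.
apply/times_differentiableSS; split; first by apply: nearT => z; exact: derivable_cst.
by rewrite (_ : (cst c)^`() = cst 0)//; apply/funext => z; rewrite derive1_cst.
Qed.

Lemma times_differentiableD n f g x :
  times_differentiable n f x -> times_differentiable n g x ->
  times_differentiable n (fun z => f z + g z) x.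
Proof.
elim: n f g x => [//|[|n] IH] f g x.
  by rewrite !times_differentiable1; exact: derivableD.
rewrite !times_differentiableSS => -[df df'] [dg dg']; split.
  by apply: filterS2 df dg => z; exact: derivableD.
apply: near_eq_times_differentiable (IH _ _ _ df' dg').
by apply: filterS2 df dg => z dfz dgz; rewrite derive1D.
Qed.

(** Near [x] the derivative is [f g' + g f'], and the induction hypothesis applies to each product,
    with [f] and [g] taken at one order less. Inverses and compositions follow the same pattern. *)
Lemma times_differentiableM n f g x :
  times_differentiable n f x -> times_differentiable n g x ->
  times_differentiable n (fun z => f z * g z) x.
Proof.
elim: n f g x => [//|[|n] IH] f g x.
  by rewrite !times_differentiable1; exact: derivableM.
move=> tf tg; have tf1 := times_differentiableW _ _ _ tf.
have tg1 := times_differentiableW _ _ _ tg.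
move: tf tg; rewrite !times_differentiableSS => -[df df'] [dg dg']; split.
  by apply: filterS2 df dg => z; exact: derivableM.
apply: near_eq_times_differentiable
  (times_differentiableD _ _ _ _ (IH _ _ _ tf1 dg') (IH _ _ _ tg1 df')).
by apply: filterS2 df dg => z dfz dgz; rewrite derive1M.
Qed.

Lemma times_differentiableV n f x : f x != 0 ->
  times_differentiable n f x -> times_differentiable n (fun z => (f z)^-1) x.
Proof.
elim: n x => [//|[|n] IH] x fx0.
  by rewrite !times_differentiable1; exact: derivableV.
move=> tf; have tf1 := times_differentiableW _ _ _ tf.
have f0 : \forall z \near x, f z != 0.
  apply: continuous_near_neq0 fx0.
  exact: derivable_continuous (times_differentiable_derivable _ _ _ tf).
move: tf; rewrite !times_differentiableSS => -[df df']; split.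
  by apply: filterS2 f0 df => z; exact: derivableV.
have tV := IH _ fx0 tf1.
have tVV := times_differentiableM _ _ _ _ tV tV.
apply: near_eq_times_differentiable (times_differentiableM _ _ _ _
  (times_differentiable_cst _ (-1) _) (times_differentiableM _ _ _ _ tVV df')).
apply: filterS2 f0 df => z fz0 dfz; rewrite derive1V//=.
by rewrite -exprVn expr2 mulN1r mulNr.
Qed.

Lemma times_differentiable_comp n f g x :
  times_differentiable n f x -> times_differentiable n g (f x) ->
  times_differentiable n (g \o f) x.
Proof.
elim: n f g x => [//|[|n] IH] f g x.
  rewrite !times_differentiable1 => /derivable1_diffP df /derivable1_diffP dg.
  by apply/derivable1_diffP; exact: differentiable_comp.
move=> tf; have tf1 := times_differentiableW _ _ _ tf.
have cf := derivable_continuous _ _ (times_differentiable_derivable _ _ _ tf).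
move: tf; rewrite !times_differentiableSS => -[df df'] [/cf dg dg']; split.
  apply: filterS2 df dg => z /derivable1_diffP dfz /derivable1_diffP dgz.
  by apply/derivable1_diffP; exact: differentiable_comp.
apply: near_eq_times_differentiable
  (times_differentiableM _ _ _ _ (IH _ _ _ tf1 dg') df').
by apply: filterS2 df dg => z dfz dgz; exact: (esym (derive1_comp dfz dgz)).
Qed.

Lemma times_differentiable_horner n (p : {poly R}) x :
  times_differentiable n (horner p) x.
Proof.
elim: n p x => [//|[|n] IH] p x.
  by apply/times_differentiable1; exact: derivable_horner.
apply/times_differentiableSS; split.
  by apply: nearT => z; exact: derivable_horner.
by rewrite -derivE.
Qed.

Lemma times_differentiable_ratmap n (r : ratmap R) x : finite_at r x ->
  times_differentiable n r x.
Proof.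
move=> rx; apply: times_differentiableM; first exact: times_differentiable_horner.
apply: times_differentiableV; first exact: rx.
exact: times_differentiable_horner.
Qed.

(** * The mean value inequality and local inverses *)

Lemma mvt_ball f x r M :
  (forall z, `|z - x| <= r -> derivable f z 1 /\ `|derive1 f z| <= M) ->
  forall a b, `|a - x| <= r -> `|b - x| <= r -> `|f b - f a| <= M * `|b - a|.
Proof.
move=> fM a b; wlog ab : a b / a <= b.
  move=> H ax bx; case/orP: (le_total a b) => ab; first exact: H.
  by rewrite distrC (distrC b); exact: H.
move=> ax bx; have inball z : z \in `[a, b]%R -> `|z - x| <= r.
  rewrite in_itv/= => /andP[az zb]; move: ax bx.
  by rewrite !ler_distl => /andP[? ?] /andP[? ?]; apply/andP; split; lra.
have [c cab ->] : exists2 c, c \in `[a, b]%R & f b - f a = derive1 f c * (b - a).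
  apply: MVT_segment => // [z /subset_itv_oo_cc zab|].
    by rewrite derive1E; apply: derivableP; have [] := fM z (inball _ zab).
  apply: derivable_within_continuous => z zab.
  by have [] := fM z (inball _ zab).
by rewrite normrM ler_wpM2r//; have [] := fM c (inball _ cab).
Qed.

(** As [f'] is continuous at [x], the derivative of [f z - f'(x) z] is at most [e] in absolute value
    near [x], and the mean value inequality bounds its increments. Both endpoints may vary, which
    derivability at [x] alone does not allow. *)
Lemma strict_derivative f x (e : R) : 0 < e -> times_differentiable 2 f x ->
  exists2 r, 0 < r & forall a b, `|a - x| <= r -> `|b - x| <= r ->
    `|f b - f a - derive1 f x * (b - a)| <= e * `|b - a|.
Proof.
move=> e0 /times_differentiableSS[df /times_differentiable_derivable df'].
have /cvgrPdist_le/(_ e e0) near_e := derivable_continuous _ _ df'.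
have /nbhs_ballP[d /= d0 dP] : \forall z \near x,
    derivable f z 1 /\ `|derive1 f x - derive1 f z| <= e.
  by near=> z; split; near: z.
exists (d / 2); first by rewrite divr_gt0.
move=> a b ax bx.
pose h z := f z - derive1 f x * z.
have -> : f b - f a - derive1 f x * (b - a) = h b - h a by rewrite /h; ring.
apply: mvt_ball ax bx => z zx.
have [|dfz fz] := dP z.
  by rewrite /ball/= distrC (le_lt_trans zx)// ltr_pdivrMr// ltr_pMr// ltr1n.
have dl : derivable (fun w : R => derive1 f x * w) z 1.
  by apply: derivableM; [exact: derivable_cst|exact: derivable_id].
split; first exact: derivableB.
rewrite derive1E deriveB// -(derive1E f) (_ : 'D_1 _ z = derive1 f x).
  by rewrite distrC.
by rewrite deriveMl// derive_id mulr1.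
Unshelve. all: by end_near. Qed.

(** Strict differentiability with error [|f'(x)| / 2] makes [f] injective on a ball around [x].
    Choosing the preimage in that ball gives a left inverse near [x], and continuity of [f] near [x]
    makes it a right inverse near [f x]. *)
Lemma local_inverse_exists f x : times_differentiable 2 f x -> f^`() x != 0 ->
  exists phi, is_local_inverse f x phi.
Proof.
move=> tf f'0; have e0 : 0 < `|derive1 f x| / 2 by rewrite divr_gt0 ?normr_gt0.
have [r r0 fr] := strict_derivative _ _ _ e0 tf.
have finj a b : `|a - x| <= r -> `|b - x| <= r -> f a = f b -> a = b.
  move=> ax bx fab; have := fr a b ax bx.
  rewrite fab subrr sub0r normrN normrM => H.
  have : `|derive1 f x| / 2 * `|b - a| <= 0 by lra.
  rewrite pmulr_rle0// normr_le0 subr_eq0 => /eqP//.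
pose phi w := xget x [set z | `|z - x| <= r /\ f z = w].
have phiK : \forall z \near x, phi (f z) = z.
  apply/nbhs_ballP; exists r => //= z; rewrite /ball/= distrC => /ltW zx.
  have [] : [set z' | `|z' - x| <= r /\ f z' = f z] (phi (f z)).
    by apply: xgetPex; exists z.
  by move=> H1 H2; exact: finj.
exists phi; split => //; first exact: nbhs_singleton phiK.
apply: near_continuous_can_sym phiK.
move: tf => /times_differentiableSS[+ _]; apply: filterS => z.
exact: derivable_continuous.
Qed.

(** Near [f x] one has [phi' = 1 / (f' \o phi)], so the order known for [phi] passes to [phi'] and
    rises by one. Derivability near [x] is assumed separately: continuity of [phi] rests on it, and
    for [n <= 1] it does not follow from the order. *)
Lemma times_differentiable_local_inverse n f phi x :
  times_differentiable n f x -> f^`() x != 0 -> is_local_inverse f x phi ->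
  (\forall z \near x, derivable f z 1) ->
  times_differentiable n phi (f x).
Proof.
move=> + f'0 [phix phiK fK] df.
have cf : \forall z \near x, {for z, continuous f}.
  by move: df; apply: filterS => z; exact: derivable_continuous.
have cphi : \forall z \near f x, {for z, continuous phi}.
  exact: near_can_continuous phiK cf.
have cphix : {for f x, continuous phi} by exact: nbhs_singleton cphi.
(* Continuity of [phi] at [f x] carries what holds near [x] to the points [phi w] with [w] near
   [f x]. *)
have near_phi (P : R -> Prop) :
    (\forall z \near x, P z) -> \forall w \near f x, P (phi w).
  by rewrite -{1}phix => /cphix.
have dphi w : f (phi w) = w -> {near (phi w), cancel f phi} ->
    {near (phi w), continuous f} -> derivable f (phi w) 1 ->
    f^`() (phi w) != 0 -> is_derive w 1 phi (derive1 f (phi w))^-1.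
  move=> fw K c d d0; rewrite -{1}fw.
  have Df : is_derive (phi w) (1 : R) f (derive1 f (phi w)).
    by rewrite derive1E; exact: derivableP.
  exact: is_derive_inverse K c Df d0.
elim: n => [//|[|n] IH] tf.
  apply/times_differentiable1.
  have [] // : is_derive (f x) 1 phi (derive1 f (phi (f x)))^-1.
  by apply: dphi; rewrite ?phix //; exact: nbhs_singleton df.
have tf1 := times_differentiableW _ _ _ tf.
move: tf; rewrite times_differentiableSS => -[_ tf'].
have f'n0 : \forall z \near x, f^`() z != 0.
  have cf' : {for x, continuous f^`()}.
    exact: derivable_continuous (times_differentiable_derivable _ _ _ tf').
  exact: continuous_near_neq0 f'0.
have near_dphi : \forall w \near f x, is_derive (w : R) (1 : R) phi (derive1 f (phi w))^-1.
  near=> w; apply: dphi.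
  - by near: w.
  - by near: w; apply: (near_phi (fun z => {near z, cancel f phi})); exact: near_near.
  - by near: w; apply: (near_phi (fun z => {near z, continuous f})); exact: near_near cf.
  - by near: w; exact: (near_phi (fun z => derivable f z 1) df).
  - by near: w; exact: (near_phi (fun z => f^`() z != 0) f'n0).
apply/times_differentiableSS; split.
  by move: near_dphi; apply: filterS => z [].
apply: (near_eq_times_differentiable _ (fun w => (derive1 f (phi w))^-1)).
  move: near_dphi; apply: filterS => w [_ <-]; by rewrite derive1E.
apply: times_differentiableV; first by rewrite phix.
apply: (times_differentiable_comp _ phi f^`()); first exact: IH.
by rewrite phix.
Unshelve. all: by end_near. Qed.


End IteratedDerivatives.

(** * Taylor expansions with Peano remainder *)

Section PeanoExpansions.
Context {R : realType}.
Implicit Types (f g h u v w : R -> R) (x y z c e : R) (n m k : nat).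

(** The relation [u z = o((z - x)^n)], written without division so that it includes [z = x] and
    forces [u x = 0]. *)
Definition peano_small n x u :=
  forall e, 0 < e -> \forall z \near x, `|u z| <= e * `|z - x| ^+ n.

Lemma near_norm_le x r : 0 < r -> \forall z \near x, `|z - x| <= r.
Proof.
move=> r0; apply/nbhs_ballP; exists r => //= z.
by rewrite /ball/= distrC => /ltW.
Qed.

Lemma near_eq_peano_small n x u v : (\forall z \near x, u z = v z) ->
  peano_small n x u -> peano_small n x v.
Proof. by move=> uv su e e0; apply: filterS2 uv (su e e0) => z ->. Qed.

Lemma peano_smallD n x u v : peano_small n x u -> peano_small n x v ->
  peano_small n x (fun z => u z + v z).
Proof.
move=> su sv e e0; have e20 : 0 < e / 2 by rewrite divr_gt0.
apply: filterS2 (su _ e20) (sv _ e20) => z uz vz.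
rewrite (le_trans (ler_normD _ _))// (le_trans (lerD uz vz))//.
by rewrite -mulrDl -splitr.
Qed.

Lemma peano_smallZ n x u c : peano_small n x u -> peano_small n x (fun z => c * u z).
Proof.
move=> su e e0; have c0 : 0 < `|c| + 1 by rewrite ltr_pwDr.
have ec0 : 0 < e / (`|c| + 1) by rewrite divr_gt0.
apply: filterS (su _ ec0) => z uz; rewrite normrM.
rewrite (le_trans (ler_wpM2l (normr_ge0 c) uz))// mulrA ler_wpM2r ?exprn_ge0//.
by rewrite mulrCA ger_pMr// ler_pdivrMr// mul1r lerDl.
Qed.

Lemma peano_smallB n x u v : peano_small n x u -> peano_small n x v ->
  peano_small n x (fun z => u z - v z).
Proof.
move=> su /(peano_smallZ _ _ _ (-1)) /(peano_smallD _ _ _ _ su).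
by apply: near_eq_peano_small; near=> z; rewrite mulN1r.
Unshelve. all: by end_near. Qed.

Lemma peano_small_leq m n x u : (m <= n)%N -> peano_small n x u -> peano_small m x u.
Proof.
move=> mn su e e0; apply: filterS2 (su e e0) (near_norm_le x 1 ltr01) => z uz zx.
by rewrite (le_trans uz)// ler_pM2l// ler_wiXn2l.
Qed.

Lemma peano_small_monomial n x c : peano_small n x (fun z => c * (z - x) ^+ n) ->
  c = 0.
Proof.
move=> sc; apply/eqP; apply/negPn/negP => c0.
have c20 : 0 < `|c| / 2 by rewrite divr_gt0 ?normr_gt0.
have /nbhs_ballP[d /= d0 dP] := sc _ c20.
(* At the point [x + d / 2] of the ball, the bound with error [|c| / 2] reads [|c| <= |c| / 2]. *)
have := dP (x + d / 2); rewrite /ball/= opprD addrA subrr sub0r normrN.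
have d20 : 0 < d / 2 by rewrite divr_gt0.
rewrite gtr0_norm// ltr_pdivrMr// ltr_pMr// ltr1n => /(_ isT).
rewrite addrAC subrr add0r normrM normrX (gtr0_norm d20) ler_pM2r ?exprn_gt0//.
by move: c20; lra.
Qed.

Lemma vanishing_peano_small n u x : times_differentiable n.+1 u x ->
  (forall j, (j <= n.+1)%N -> derive1n j u x = 0) -> peano_small n.+1 x u.
Proof.
elim: n u x => [|n IH] u x tu u0; have ux : u x = 0 := u0 0%N isT.
  move=> e e0; have [_ du] := tu.
  have /is_derive1_caratheodory[q [uq cq qx]] := derivableP du.
  have {}qx : q x = 0 by rewrite qx -derive1E; exact: (u0 1%N).
  have /cvgrPdist_le/(_ e e0) near_e := cq.
  near=> z; have := uq z; rewrite derive1n0 ux subr0 => ->.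
  rewrite normrM expr1 ler_wpM2r//.
  have : `|q x - q z| <= e by near: z.
  by rewrite qx sub0r normrN.
move/times_differentiableSS : tu => [du du'] e e0.
have su' : peano_small n.+1 x (derive1 u).
  by apply: IH du' _ => j jn; rewrite -derive1Sn u0.
have /nbhs_ballP[d /= d0 dP] : \forall z \near x,
    derivable u z 1 /\ `|derive1 u z| <= e * `|z - x| ^+ n.+1.
  by apply: filterS2 du (su' e e0).
apply/nbhs_ballP; exists d => //= z; rewrite /ball/= => zd.
have := @mvt_ball _ u x `|z - x| (e * `|z - x| ^+ n.+1).
move=> /(_ _ x z); rewrite subrr normr0 ux subr0 -mulrA -exprSr.
apply => // w wz; have [] := dP w; first by rewrite /ball/= distrC (le_lt_trans wz)// distrC.
move=> dw uw; split => //; rewrite (le_trans uw)// ler_pM2l// lerXn2r//.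
Unshelve. all: by end_near. Qed.

Lemma derive1nB n u v x : times_differentiable n u x -> times_differentiable n v x ->
  derive1n n (fun z => u z - v z) x = derive1n n u x - derive1n n v x.
Proof.
elim: n u v => [//|[|n] IH] u v.
  by move=> /times_differentiable1 du /times_differentiable1 dv; exact: derive1B.
move=> /times_differentiableSS[du du'] /times_differentiableSS[dv dv'].
rewrite (derive1Sn u) (derive1Sn v) -IH// derive1Sn; apply: derive1n_near.
by apply: filterS2 du dv => z duz dvz; exact: derive1B.
Qed.

Lemma times_differentiableB n u v x :
  times_differentiable n u x -> times_differentiable n v x ->
  times_differentiable n (fun z => u z - v z) x.
Proof.
move=> tu tv; rewrite (_ : (fun z => _) = fun z => u z + (cst (-1) z) * v z).
  apply: times_differentiableD tu _.
  exact: times_differentiableM (times_differentiable_cst _ _ _) tv.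
by apply/funext => z /=; rewrite mulN1r.
Qed.

Lemma monomialE x c k :
  (fun z => c * (z - x) ^+ k) = horner (c%:P * ('X - x%:P) ^+ k).
Proof. by apply/funext => z; rewrite !hornerE. Qed.

Lemma times_differentiable_monomial n x c k y :
  times_differentiable n (fun z => c * (z - x) ^+ k) y.
Proof. by rewrite monomialE; exact: times_differentiable_horner. Qed.

Lemma derive1n_monomial j k x c :
  derive1n j (fun z => c * (z - x) ^+ (j + k)) =
  fun z => c * ((j + k) ^_ j)%:R * (z - x) ^+ k.
Proof.
elim: j c => [|j IH] c; first by rewrite ffactn0 mulr1.
rewrite derive1Sn (_ : derive1 _ = fun z => c * (j.+1 + k)%:R * (z - x) ^+ (j + k)).
  by rewrite IH addSn ffactSS natrM mulrA.
rewrite !monomialE -derivE; congr horner.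
rewrite derivM derivC mul0r add0r deriv_exp derivXsubC mul1r addSn/=.
by rewrite polyCM polyCMn -mulr_natr; ring.
Qed.

Lemma derive1n_monomial_at j n x c : (j <= n)%N ->
  derive1n j (fun z => c * (z - x) ^+ n) x = if j == n then c * n`!%:R else 0.
Proof.
move=> /subnKC <-; rewrite derive1n_monomial subrr expr0n.
case: (n - j)%N => [|k]; first by rewrite addn0 !eqxx mulr1 ffactnn.
by rewrite mulr0 ifN// -[X in X != _]addn0 eqn_add2l.
Qed.

(** Strong induction on the order [j]: once the lower derivatives vanish, subtracting the monomial
    of degree [j] with coefficient [u^(j)(x) / j!] leaves a function small of order [j]. As [u] is
    also small of that order, so is the monomial, and its coefficient is zero. *)
Lemma peano_small_vanishing n u x : times_differentiable n.+1 u x ->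
  peano_small n.+1 x u -> forall j, (j <= n.+1)%N -> derive1n j u x = 0.
Proof.
move=> tu su j; elim/ltn_ind: j => -[|j] IH jn.
  have := nbhs_singleton (peano_small_leq 1 n.+1 _ _ isT su 1 ltr01).
  by rewrite subrr normr0 expr1 mulr0 normr_le0 => /eqP.
set c := derive1n j.+1 u x; pose a := c / j.+1`!%:R.
have f0 : (j.+1)`!%:R != 0 :> R by rewrite pnatr_eq0 -lt0n fact_gt0.
suff a0 : a = 0 by rewrite -[c](divfK f0) -/a a0 mul0r.
apply: (@peano_small_monomial j.+1 x).
have tuj k : (k <= j.+1)%N -> times_differentiable k u x.
  by move=> kj; apply: times_differentiable_leq tu; exact: leq_trans jn.
pose m z := a * (z - x) ^+ j.+1.
have smd : peano_small j.+1 x (fun z => u z - m z).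
  apply: vanishing_peano_small => [|k kj].
    exact: times_differentiableB (tuj _ (leqnn _)) (times_differentiable_monomial _ _ _ _ _).
  rewrite derive1nB; [|exact: tuj|exact: times_differentiable_monomial].
  rewrite derive1n_monomial_at//; case: eqVneq => [->|kj']; first by rewrite divfK// subrr.
  by rewrite subr0 IH// 1?ltn_neqAle ?kj'// (leq_trans kj).
have := peano_smallB _ _ _ _ (peano_small_leq _ _ _ _ jn su) smd.
by apply: near_eq_peano_small; near=> z; rewrite opprB addrC subrK.
Unshelve. all: by end_near. Qed.

End PeanoExpansions.

(** * Expansions of composite functions *)

Section Composition.
Context {R : realType}.
Implicit Types (f g h u v w F G : R -> R) (x y z a c e : R) (n m k : nat).

(** Both directions apply the equivalence of smallness and vanishing derivatives to
    [u - v - c (z - x)^(n+1)]. Up to order [n + 1] the monomial only contributes [c (n+1)!], to the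
    top derivative at [x]. *)
Lemma peano_smallP n u v c x :
  times_differentiable n.+1 u x -> times_differentiable n.+1 v x ->
  peano_small n.+1 x (fun z => u z - v z - c * (z - x) ^+ n.+1) <->
  (forall j, (j <= n)%N -> derive1n j u x = derive1n j v x) /\
  derive1n n.+1 u x = derive1n n.+1 v x + c * (n.+1)`!%:R.
Proof.
move=> tu tv; pose m z := c * (z - x) ^+ n.+1.
have tm j : times_differentiable j m x by exact: times_differentiable_monomial.
have tW := times_differentiableB _ _ _ _ (times_differentiableB _ _ _ _ tu tv) (tm _).
have W j : (j <= n.+1)%N -> derive1n j (fun z => u z - v z - m z) x =
    derive1n j u x - derive1n j v x - (if j == n.+1 then c * (n.+1)`!%:R else 0).
  move=> jn; have tuj := times_differentiable_leq _ _ _ _ jn tu.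
  have tvj := times_differentiable_leq _ _ _ _ jn tv.
  rewrite (derive1nB j (fun z => u z - v z)) ?derive1nB//.
    by rewrite derive1n_monomial_at.
  exact: times_differentiableB.
split=> [/(peano_small_vanishing _ _ _ tW) W0 | [uv uvn]].
  split=> [j jn|].
    apply/eqP; rewrite -subr_eq0 -[X in X == _]subr0.
    have := W j (leqW jn); rewrite W0 ?leqW// ltn_eqF ?ltnS// => <- //.
  by apply/eqP; have := W n.+1 (leqnn _); rewrite W0// eqxx => /eqP;
     rewrite eq_sym !subr_eq0 subr_eq addrC.
apply: vanishing_peano_small tW _ => j jn; rewrite W//.
case: eqVneq jn => [-> _|jn]; first by rewrite uvn; ring.
by rewrite leq_eqVlt (negPf jn)/= ltnS => /uv ->; ring.
Qed.

(** Both [u z] and [v z] move, so strict differentiability of [G] is used: [G (u z) - G (v z)] is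
    [G'(v x) (u z - v z)] up to [o(|u z - v z|)], and [u z - v z] is [O((z - x)^n)]. *)
Lemma peano_small_compl n c G u v x : times_differentiable 2 G (v x) ->
  {for x, continuous u} -> {for x, continuous v} -> u x = v x ->
  peano_small n x (fun z => u z - v z - c * (z - x) ^+ n) ->
  peano_small n x (fun z => G (u z) - G (v z) - derive1 G (v x) * c * (z - x) ^+ n).
Proof.
move=> tG cu cv uv su.
suff sG : peano_small n x (fun z => G (u z) - G (v z) - derive1 G (v x) * (u z - v z)).
  have := peano_smallD _ _ _ _ sG (peano_smallZ _ _ _ (derive1 G (v x)) su).
  by apply: near_eq_peano_small; near=> z; ring.
move=> e e0; have c0 : 0 < `|c| + 1 by rewrite ltr_pwDr.
(* The divisor absorbs the bound [|u z - v z| <= (|c| + 1) |z - x|^n], whose 1 comes from the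
   hypothesis taken with error 1. *)
have ec0 : 0 < e / (`|c| + 1) by rewrite divr_gt0.
have [r r0 Gr] := strict_derivative _ _ _ ec0 tG.
have /cvgrPdist_le/(_ r r0) ur := cu.
have /cvgrPdist_le/(_ r r0) vr := cv.
have uvz := su 1 ltr01.
near=> z; apply: le_trans (Gr (v z) (u z) _ _) _.
- by rewrite distrC; near: z.
- by rewrite distrC -uv; near: z.
rewrite mulrAC ler_pdivrMr// -mulrA ler_pM2l// mulrC.
have -> : u z - v z = (u z - v z - c * (z - x) ^+ n) + c * (z - x) ^+ n by ring.
rewrite (le_trans (ler_normD _ _))// mulrDl addrC.
rewrite lerD ?normrM ?normrX//.
by near: z.
Unshelve. all: by end_near. Qed.

(** Write [f z - f x = q z (z - x)] with [q] continuous at [x] and [q x = f'(x)]. Substituting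
    [s = f z] gives the coefficient [a (q z)^n], and replacing [q z] by [q x] costs only a small
    term. *)
Lemma peano_small_compr n a w f x : derivable f x 1 ->
  peano_small n (f x) (fun s => w s - a * (s - f x) ^+ n) ->
  peano_small n x (fun z => w (f z) - a * derive1 f x ^+ n * (z - x) ^+ n).
Proof.
move=> df sw; have cf := derivable_continuous _ _ df.
have /is_derive1_caratheodory[q [fq cq qx]] := derivableP df.
rewrite -derive1E in qx.
have sq : peano_small n x (fun z => (q z ^+ n - q x ^+ n) * (z - x) ^+ n).
  move=> e e0.
  have cqn : {for x, continuous (fun z => q z ^+ n)}.
    by apply: (@continuous_comp _ _ _ q (fun t => t ^+ n)) => //; exact: exprn_continuous.
  have /cvgrPdist_le/(_ e e0) := cqn; apply: filterS => z qz.
  by rewrite normrM normrX ler_wpM2r ?exprn_ge0// distrC.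
have swf : peano_small n x (fun z => w (f z) - a * (q z * (z - x)) ^+ n).
  move=> e e0; pose K := `|q x| + 1; have K0 : 0 < K by rewrite ltr_pwDr.
  have eK0 : 0 < e / K ^+ n by rewrite divr_gt0// exprn_gt0.
  have /cvgrPdist_le/(_ 1 ltr01) q1 := cq.
  have /cf sf := sw _ eK0.
  apply: filterS2 q1 sf => z qz; rewrite /= fq => /le_trans; apply.
  rewrite normrM exprMn mulrA ler_wpM2r ?exprn_ge0// -mulrA ger_pMr//.
  rewrite ler_pdivrMl ?exprn_gt0// mulr1 lerXn2r ?nnegrE ?(ltW K0)//.
  rewrite -[q z](subrK (q x)) addrC (le_trans (ler_normD _ _))// lerD2l.
  by rewrite distrC.
have := peano_smallD _ _ _ _ swf (peano_smallZ _ _ _ a sq).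
apply: near_eq_peano_small; near=> z; rewrite exprMn -qx; ring.
Unshelve. all: by end_near. Qed.

(** The term [(g - G) f] is handled by [peano_small_compr] and [G f - G F] by [peano_small_compl].
    The top order is [n.+2] so that [G] is twice differentiable, as strict differentiability
    asks. *)
Lemma derive1n_comp_diff n f F g G x :
  times_differentiable n.+2 f x -> times_differentiable n.+2 F x ->
  times_differentiable n.+2 g (f x) -> times_differentiable n.+2 G (f x) ->
  (forall j, (j <= n.+1)%N -> derive1n j f x = derive1n j F x) ->
  (forall j, (j <= n.+1)%N -> derive1n j g (f x) = derive1n j G (f x)) ->
  (forall j, (j <= n.+1)%N -> derive1n j (g \o f) x = derive1n j (G \o F) x) /\
  derive1n n.+2 (g \o f) x = derive1n n.+2 (G \o F) x
    + (derive1n n.+2 g (f x) - derive1n n.+2 G (f x)) * derive1 f x ^+ n.+2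
    + derive1 G (f x) * (derive1n n.+2 f x - derive1n n.+2 F x).
Proof.
move=> tf tF tg tG fF gG; have Fx : f x = F x := fF 0%N isT.
have N0 : (n.+2)`!%:R != 0 :> R by rewrite pnatr_eq0 -lt0n fact_gt0.
have recombine (D A B p q N : R) :
    N != 0 -> D + (A / N * p + q * (B / N)) * N = D + A * p + q * B.
  by move=> N_neq0; field.
(* [b] and [a] are the differences of the top Taylor coefficients of [f] and [F] at [x], and of [g]
   and [G] at [f x]. *)
pose b := (derive1n n.+2 f x - derive1n n.+2 F x) / (n.+2)`!%:R.
pose a := (derive1n n.+2 g (f x) - derive1n n.+2 G (f x)) / (n.+2)`!%:R.
have sf : peano_small n.+2 x (fun z => f z - F z - b * (z - x) ^+ n.+2).
  by apply/peano_smallP => //; split => //; rewrite divfK// addrC subrK.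
have sg : peano_small n.+2 (f x) (fun z => g z - G z - a * (z - f x) ^+ n.+2).
  by apply/peano_smallP => //; split => //; rewrite divfK// addrC subrK.
have df := times_differentiable_derivable _ _ _ tf.
have dF := times_differentiable_derivable _ _ _ tF.
have sgf := peano_small_compr _ _ (fun z => g z - G z) _ _ df sg.
have sGf : peano_small n.+2 x
    (fun z => G (f z) - G (F z) - derive1 G (F x) * b * (z - x) ^+ n.+2).
  have tG2 : times_differentiable 2 G (F x).
    by rewrite -Fx; apply: times_differentiable_leq tG.
  exact: (peano_small_compl _ _ _ _ _ _ tG2 (derivable_continuous _ _ df)
    (derivable_continuous _ _ dF) Fx sf).
have tgf : times_differentiable n.+2 (g \o f) x by exact: times_differentiable_comp.
have tGF : times_differentiable n.+2 (G \o F) x.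
  by apply: times_differentiable_comp; rewrite -?Fx.
have [+ _] := peano_smallP _ _ _ (a * derive1 f x ^+ n.+2 + derive1 G (f x) * b) _ tgf tGF.
case=> [|eqs eqn].
  apply: near_eq_peano_small (peano_smallD _ _ _ _ sgf sGf).
  by near=> z; rewrite -Fx /=; ring.
split; first exact: eqs.
by rewrite eqn /a /b; exact: recombine.
Unshelve. all: by end_near. Qed.

End Composition.

(** * Pade approximants and Schwarzian derivatives *)

Section Schwarzian.
Context {R : realType}.
Implicit Types (f g h phi : R -> R) (x y : R) (k n : nat).

Lemma derive1n_id n x : derive1n n.+2 (idfun : R -> R) x = 0.
Proof.
have -> : derive1n n.+2 (idfun : R -> R) = derive1n n (cst 0).
  rewrite !derive1Sn; congr (derive1n n _); apply/funext => z.
  rewrite -(@derive1_cst _ _ (1 : R) z); congr derive1; apply/funext => w.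
  by rewrite derive1E derive_id.
elim: n => // n IH; rewrite derive1Sn (_ : derive1 (cst 0) = cst 0)//.
by apply/funext => z; exact: derive1_cst.
Qed.

Lemma derive1_local_inverse f phi x : derivable f x 1 -> derivable phi (f x) 1 ->
  is_local_inverse f x phi -> derive1 phi (f x) * derive1 f x = 1.
Proof.
move=> df dphi [_ phiK _]; rewrite -(derive1_comp df dphi).
rewrite (near_eq_derive1 _ (idfun : R -> R))//.
by rewrite derive1E derive_id.
Qed.

Lemma padeP k h y : schwarzian_exists k h y -> is_pade k h y (pade k h y).
Proof. by move=> ex; apply: xgetPex. Qed.

(** Equal predicates make [pade] choose the same rational map for both functions. *)
Lemma eq_pade k h1 h2 y :
  (forall j, (j <= 2 * k)%N -> derive1n j h1 y = derive1n j h2 y) ->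
  is_pade k h1 y = is_pade k h2 y.
Proof.
move=> h12; apply/funext => r; apply/propext.
by split=> -[rk ry rh]; split=> // j jk; rewrite rh// h12.
Qed.

(** With [r] the approximant and [phi] its local inverse, [phi \o h] is compared with [phi \o r].
    The latter is the identity near [y], so its derivative of order [2k + 1 >= 2] vanishes, and
    [phi'(h y) = 1 / h'(y)]. *)
Lemma schwarzianE k h y : (0 < k)%N -> times_differentiable (2 * k).+1 h y ->
  derive1 h y != 0 -> schwarzian_exists k h y ->
  schwarzian k h y =
    (derive1n (2 * k).+1 h y - derive1n (2 * k).+1 (pade k h y) y) / derive1 h y.
Proof.
move=> k0 th h'0 /padeP; rewrite /schwarzian.
move: (pade k h y) => r [_ ry rh].
(* Since [k > 0], the order [2k + 1] takes the shape [m.+2] of the comparison lemma, and [r] matches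
   [h] at order 1 too. *)
have [m km] : exists m, (2 * k = m.+1)%N by exists (2 * k).-1; rewrite prednK// muln_gt0.
rewrite km in th rh *.
have tr n : times_differentiable n r y by exact: times_differentiable_ratmap.
have rhy : r y = h y := rh 0%N isT.
have r'h' : derive1 r y = derive1 h y := rh 1%N isT.
have r'0 : derive1 r y != 0 by rewrite r'h'.
have [phi0 phi0P] := local_inverse_exists _ _ (tr 2%N) r'0.
have phiP : is_local_inverse r y (local_inverse r y).
  by apply: xgetPex; exists phi0.
move: (local_inverse r y) phiP => phi phiP.
have /times_differentiableSS[dr _] := tr 2%N.
have := times_differentiable_local_inverse _ _ _ _ (tr m.+2) r'0 phiP dr.
have := derive1_local_inverse _ _ _ (nbhs_singleton dr).
rewrite rhy r'h' => phi'h' tphi.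
have {phi'h'} phi'h' := phi'h' _ (times_differentiable_derivable _ _ _ tphi) phiP.
have hr j : (j <= m.+1)%N -> derive1n j h y = derive1n j r y by move=> jm; rewrite rh.
have [//|_ ->] := derive1n_comp_diff m _ _ _ _ _ th (tr _) tphi tphi hr.
have -> : derive1n m.+2 (phi \o r) y = 0.
  by rewrite -(derive1n_id m y); apply: derive1n_near; case: phiP.
have recombine (X Y A B p q : R) : q != 0 -> p * q = 1 ->
    0 + (X - X) * Y + p * (A - B) = (A - B) / q.
  by move=> q0 pq; rewrite -[p](mulfK q0) pq; field.
exact: recombine.
Qed.

End Schwarzian.

(** * The composition formula for Schwarzian derivatives *)

Theorem lemma9 (R : realType) (d : nat) (d_gt0 : (0 < d)%N) (x : R)
    (f g : R -> R)
    (f_diff : times_differentiable (2 * d).+1 f x)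
    (g_diff : times_differentiable (2 * d).+1 g (f x))
    (Df_neq0 : derive1 f x != 0)
    (Dg_neq0 : derive1 g (f x) != 0)
    (Sf_exists : schwarzian_exists d f x)
    (Sg_exists : schwarzian_exists d g (f x))
    (Sgf_exists : schwarzian_exists d (g \o f) x) :
  schwarzian_exists d (pade d g (f x) \o pade d f x) x /\
  schwarzian d (g \o f) x =
    schwarzian d g (f x) * (derive1 f x) ^+ (2 * d)
    + schwarzian d f x
    + schwarzian d (pade d g (f x) \o pade d f x) x.
Proof.
have [m dm] : exists m, (2 * d = m.+1)%N.
  by exists (2 * d).-1; rewrite prednK// muln_gt0.
have [_ Fx Ff] := padeP _ _ _ Sf_exists.
have [_ Gy Gg] := padeP _ _ _ Sg_exists.
have := schwarzianE _ _ _ d_gt0 f_diff Df_neq0 Sf_exists.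
have := schwarzianE _ _ _ d_gt0 g_diff Dg_neq0 Sg_exists.
move: (pade d f x) Fx Ff => F Fx Ff.
move: (pade d g (f x)) Gy Gg => G Gy Gg Sg Sf.
have tF n : times_differentiable n F x by exact: times_differentiable_ratmap.
have tG n : times_differentiable n G (f x) by exact: times_differentiable_ratmap.
have Fxx : F x = f x := Ff 0%N isT.
have d21 : (1 <= 2 * d)%N by rewrite muln_gt0.
have F'f' : derive1 F x = derive1 f x := Ff 1%N d21.
have G'g' : derive1 G (f x) = derive1 g (f x) := Gg 1%N d21.
have df := times_differentiable_derivable _ _ _ f_diff.
have dg := times_differentiable_derivable _ _ _ g_diff.
have tgf : times_differentiable (2 * d).+1 (g \o f) x :=
  times_differentiable_comp _ _ _ _ f_diff g_diff.
have tGF : times_differentiable (2 * d).+1 (G \o F) x.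
  have tGFx : times_differentiable (2 * d).+1 G (F x).
    by rewrite Fxx; exact: tG.
  exact: (times_differentiable_comp _ _ _ _ (tF _) tGFx).
have Dgf : derive1 (g \o f) x = derive1 g (f x) * derive1 f x :=
  derive1_comp df dg.
have Dgf_neq0 : derive1 (g \o f) x != 0 by rewrite Dgf mulf_neq0.
have [gfGF gfGFn] : (forall j, (j <= 2 * d)%N ->
      derive1n j (g \o f) x = derive1n j (G \o F) x) /\
    derive1n (2 * d).+1 (g \o f) x = derive1n (2 * d).+1 (G \o F) x
      + (derive1n (2 * d).+1 g (f x) - derive1n (2 * d).+1 G (f x))
        * derive1 f x ^+ (2 * d).+1
      + derive1 G (f x) * (derive1n (2 * d).+1 f x - derive1n (2 * d).+1 F x).
  have fF j jd : derive1n j f x = derive1n j F x := esym (Ff j jd).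
  have gG j jd : derive1n j g (f x) = derive1n j G (f x) := esym (Gg j jd).
  rewrite dm in f_diff g_diff fF gG *.
  exact: (derive1n_comp_diff _ _ _ _ _ _ f_diff (tF _) g_diff (tG _) fF gG).
have DGF : derive1 (G \o F) x = derive1 (g \o f) x := esym (gfGF 1%N d21).
(* Agreement up to order [2d] gives [g \o f] and [G \o F] a common approximant, so existence passes
   to [G \o F]. *)
have pade_gf := eq_pade _ _ _ _ gfGF.
have SGF_exists : schwarzian_exists d (G \o F) x.
  by case: Sgf_exists => r; rewrite pade_gf; exists r.
split=> //; rewrite Sg Sf !schwarzianE ?DGF//.
have -> : pade d (g \o f) x = pade d (G \o F) x by rewrite /pade pade_gf.
(* [D] and [P] stand for the top derivatives of [G \o F] and of the common approximant, [A] and [B]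
   for those of [g - G] and [f - F], and [p], [q] for [f'(x)], [g'(f x)]. Dividing by
   [(g f)'(x) = q p] lowers the exponent [2d + 1] to [2d]. *)
have recombine (D A B P p q : R) : p != 0 -> q != 0 ->
    (D + A * p ^+ (2 * d).+1 + q * B - P) / (q * p) =
    A / q * p ^+ (2 * d) + B / p + (D - P) / (q * p).
  by move=> p0 q0; rewrite exprS; field; rewrite p0.
by rewrite gfGFn Dgf G'g'; exact: recombine.
Qed.
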